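(* Let $X$ be a proper, CAT(0) and Gromov hyperbolic space. Then $X$ is boundary continuous.
   Context: For $x,y,z\in X$, $(y|z)_x=\frac12(d(x,y)+d(x,z)-d(y,z))$ is the Gromov product. For a proper geodesic Gromov hyperbolic space $X$, $\overline X=X\cup\partial X$ denotes its visual (Gromov) compactification, which for a proper CAT(0) Gromov hyperbolic space coincides with the CAT(0) visual compactification equipped with the cone topology. $X$ is boundary continuous if for each $x\in X$ the Gromov product $(\cdot|\cdot)_x:X\times X\to[0,+\infty)$ extends to a continuous function $\overline X\times\overline X\to[0,+\infty]$; equivalently, for all $a,b\in\overline X$, the limit of $(y|z)_x$ exists in $[0,+\infty]$ as $y,z\in X$ converge to $a,b$ in $\overline X$ respectively. *)

(* Defs.v *)
From HB Require Import structures.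
From mathcomp Require Import all_boot all_order all_algebra.
From mathcomp Require Import all_classical all_reals all_analysis.
From mathcomp Require Import generic_quotient.

Set Implicit Arguments.
Unset Strict Implicit.
Unset Printing Implicit Defensive.
Import Order.TTheory GRing.Theory Num.Theory.
Import numFieldNormedType.Exports.
Local Open Scope classical_set_scope.
Local Open Scope quotient_scope.
Local Open Scope ring_scope.

Section MetricGeometry.
Context {R : realType} (X : metricType R).
Implicit Types (x y z w : X) (c : R -> X).

Definition proper_space : Prop :=
  forall x (r : R), compact [set y | mdist x y <= r].

Definition gromov_product w x y : R :=
  (mdist w x + mdist w y - mdist x y) / 2.

Definition gromov_hyperbolic : Prop :=
  exists delta : R, forall w x y z,
    Num.min (gromov_product w x y) (gromov_product w y z) - delta
      <= gromov_product w x z.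

(* Paths are functions on all of R, but only their values at times in
   [0, d(x, y)] (for geodesics) or [0, +oo[ (for rays) are meaningful. *)
Definition geodesic_path x y c : Prop :=
  [/\ c 0 = x, c (mdist x y) = y &
      {in `[0, mdist x y] &, forall s t, mdist (c s) (c t) = `|s - t|}].

Definition geodesic_space : Prop :=
  forall x y, exists c, geodesic_path x y c.

Definition euclidean_dist (u v : R * R) : R :=
  Num.sqrt ((u.1 - v.1) ^+ 2 + (u.2 - v.2) ^+ 2).

(* If the Euclidean distance from xb to yb is d(x, y) and z lies on a geodesic
   from x to y, these equations say that zb lies on the segment [xb, yb], at
   distance d(x, z) from xb. *)
Definition comparison_point x y z (xb yb zb : R * R) : Prop :=
  euclidean_dist xb zb = mdist x z /\ euclidean_dist zb yb = mdist z y.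

(* The geodesic triangle has vertices v i and sides c i from v i to v (i + 1),
   with indices modulo 3; vb is a comparison triangle in the plane. *)
Definition CAT0 : Prop :=
  geodesic_space /\
  forall (v : 'I_3 -> X) (c : 'I_3 -> R -> X) (vb : 'I_3 -> R * R),
    (forall i, geodesic_path (v i) (v (ordS i)) (c i)) ->
    (forall i j, euclidean_dist (vb i) (vb j) = mdist (v i) (v j)) ->
    forall (i j : 'I_3) (s t : R) (pb qb : R * R),
      s \in `[0, mdist (v i) (v (ordS i))] ->
      t \in `[0, mdist (v j) (v (ordS j))] ->
      comparison_point (v i) (v (ordS i)) (c i s) (vb i) (vb (ordS i)) pb ->
      comparison_point (v j) (v (ordS j)) (c j t) (vb j) (vb (ordS j)) qb ->
      mdist (c i s) (c j t) <= euclidean_dist pb qb.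

Record geodesic_ray := GeodesicRay {
  ray_fun :> R -> X;
  ray_isometric : forall s t : R, 0 <= s -> 0 <= t ->
    mdist (ray_fun s) (ray_fun t) = `|s - t| }.

HB.instance Definition _ := gen_eqMixin geodesic_ray.
HB.instance Definition _ := gen_choiceMixin geodesic_ray.

Definition asymptotic (g h : geodesic_ray) : Prop :=
  exists K : R, forall t : R, 0 <= t -> mdist (g t) (h t) <= K.

Definition asymptoticb : rel geodesic_ray := fun g h => `[< asymptotic g h >].

Lemma asymptoticb_refl : reflexive asymptoticb.
Proof. by move=> g; apply/asboolP; exists 0 => t _; rewrite mdistxx. Qed.

Lemma asymptoticb_sym : symmetric asymptoticb.
Proof.
move=> g h; apply/asboolP/asboolP => -[K HK]; exists K => t t0;
  by rewrite metric_sym; exact: HK.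
Qed.

Lemma asymptoticb_trans : transitive asymptoticb.
Proof.
move=> h g k /asboolP[K HK] /asboolP[L HL]; apply/asboolP; exists (K + L).
move=> t t0; apply: le_trans (metric_triangle _ (h t) _) _.
by rewrite lerD// ?HK ?HL.
Qed.

Canonical asymptotic_equiv :=
  EquivRel asymptoticb asymptoticb_refl asymptoticb_sym asymptoticb_trans.

Definition visual_boundary : Type := {eq_quot asymptotic_equiv}.

HB.instance Definition _ := gen_eqMixin visual_boundary.
HB.instance Definition _ := gen_choiceMixin visual_boundary.

(* The base point o determines which generalized rays are used to define the
   topology, but not the underlying set. *)
Definition visual_compactification (o : X) : Type := (X + visual_boundary)%type.

HB.instance Definition _ (o : X) := gen_eqMixin (visual_compactification o).
HB.instance Definition _ (o : X) := gen_choiceMixin (visual_compactification o).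

(* Generalized rays from o to a: the geodesics from o to a, made constant after
   reaching a, if a is in X, and the geodesic rays from o in the class a, if a
   is in the boundary. *)
Definition generalized_ray (o : X) (a : visual_compactification o) c : Prop :=
  match a with
  | inl y => geodesic_path o y c /\ (forall t, mdist o y <= t -> c t = y)
  | inr xi => exists g : geodesic_ray,
      [/\ c = g, c 0 = o & \pi_(visual_boundary) g = xi]
  end.

Definition cvg_uniformly_on_compacts (c_ : nat -> R -> X) c : Prop :=
  forall T e : R, 0 < e ->
    \forall n \near \oo, forall t, t \in `[0, T] -> mdist (c_ n t) (c t) < e.

Definition strictly_increasing (phi : nat -> nat) : Prop :=
  {homo phi : m n / (m < n)%N}.

Definition visual_cvg (o : X) (u : nat -> visual_compactification o)
    (a : visual_compactification o) : Prop :=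
  exists c_ : nat -> R -> X,
    (forall n, generalized_ray (u n) (c_ n)) /\
    forall phi, strictly_increasing phi ->
      exists2 psi, strictly_increasing psi &
        exists2 c, generalized_ray a c &
          cvg_uniformly_on_compacts (c_ \o (phi \o psi)) c.

Definition visual_closed (o : X) (B : set (visual_compactification o)) : Prop :=
  forall u a, (forall n, B (u n)) -> visual_cvg u a -> B a.

Definition visual_open (o : X) (A : set (visual_compactification o)) : Prop :=
  visual_closed (~` A).

Lemma visual_cvg_subseq (o : X) (u : nat -> visual_compactification o) a phi :
  strictly_increasing phi -> visual_cvg u a -> visual_cvg (u \o phi) a.
Proof.
move=> phiM [c_ [c_u cP]]; exists (c_ \o phi); split=> [n|chi chiM].
  exact: c_u.
have [|psi psiM [c ac cc]] := cP (phi \o chi).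
  by move=> m n mn; exact/phiM/chiM.
by exists psi => //; exists c.
Qed.

Lemma extract_subseq (P : nat -> Prop) :
  (forall N, exists2 n, (N <= n)%N & P n) ->
  exists2 phi, strictly_increasing phi & forall n, P (phi n).
Proof.
move=> Pinf.
have /choice[h hP] : forall N, exists n, (N <= n)%N /\ P n.
  by move=> N; have [n ? ?] := Pinf N; exists n.
pose phi := fix phi n := if n is m.+1 then h (phi m).+1 else h 0%N.
exists phi; last by case=> [|n]; exact: (hP _).2.
by apply: homo_ltn => [? ? ?|n]; [exact: ltn_trans|exact: (hP _).1].
Qed.

Lemma visual_openT (o : X) : visual_open [set: visual_compactification o].
Proof. by move=> u a uT; have := uT 0%N; rewrite setCT. Qed.

Lemma visual_openI (o : X) : setI_closed (@visual_open o).
Proof.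
move=> A B oA oB u a uAB ua [Aa Ba].
have [NA|/existsNP[N NA]] :=
  pselect (forall N, exists2 n, (N <= n)%N & (~` A) (u n)).
  have [phi phiM Hphi] := extract_subseq NA.
  exact: (oA _ _ Hphi (visual_cvg_subseq phiM ua)).
have uB n : (~` B) (u (n + N)%N).
  move=> Bu; apply: (uAB (n + N)%N); split=> //.
  by apply: contra_notP NA => nA; exists (n + N)%N => //; exact: leq_addl.
have addM : strictly_increasing (addn^~ N) by move=> m n; rewrite ltn_add2r.
exact: (oB _ _ uB (visual_cvg_subseq addM ua)).
Qed.

Lemma visual_open_bigU (o : X) (I : Type)
    (f : I -> set (visual_compactification o)) :
  (forall i, visual_open (f i)) -> visual_open (\bigcup_i f i).
Proof.
move=> of_ u a uf ua [i _ fia]; apply: (of_ i u a) => // n fiu.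
by apply: (uf n); exists i.
Qed.

HB.instance Definition _ (o : X) :=
  isOpenTopological.Build (visual_compactification o)
    (@visual_openT o) (@visual_openI o) (@visual_open_bigU o).

Definition boundary_continuous : Prop :=
  forall o x, exists f :
      visual_compactification o * visual_compactification o -> \bar R,
    [/\ continuous f,
        (forall ab, (0 <= f ab)%E) &
        forall y z, f (inl y, inl z) = (gromov_product x y z)%:E].

End MetricGeometry.

(* Main.v *)
Require Import Defs.
From mathcomp Require Import all_boot all_order all_algebra.
From mathcomp Require Import all_classical all_reals all_analysis.
From mathcomp Require Import generic_quotient ring lra.

Set Implicit Arguments.
Unset Strict Implicit.
Unset Printing Implicit Defensive.
Import Order.TTheory GRing.Theory Num.Theory.
Import numFieldNormedType.Exports.
Local Open Scope classical_set_scope.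
Local Open Scope ring_scope.

(** For a base point o and a point a of the compactification, follow the
    generalized ray from o to a up to time T; let a_T be the point reached.
    Generalized rays from o to a coincide at nonnegative times, because
    geodesics of a CAT(0) space issuing from a common point diverge at least
    linearly; hence a_T is well defined and, by the very definition of the
    topology, it depends continuously on a ([ray_continuous]).  So for each
    fixed T the product (a_T|b_T)_x is a continuous function of (a, b), and the
    extension sought is its limit as T tends to infinity.  The convergence is
    not uniform, since the limit may be infinite; what makes the limit
    continuous is that, up to an error uniform in (a, b) and small for large T,
    - the product never decreases after time T, and
    - wherever its value at time T is at most K, it does not increase either.
    These two properties say that the convergence is uniform in the topology of
    the extended half-line, and [continuous_limn_esup_sublevel] draws the
    conclusion.

    Both rest on a rate of convergence of Busemann functions.  Stewart's theorem
    compared with the Euclidean plane gives, for a point p at distance at most D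
    from o and T > D, that d(p, a_T) - d(o, a_T) decreases by at most
    D^2 / (2 (T - D)) after time T ([CAT0_busemann_rate]): in the plane the two
    rays from o and from p to a distant point are nearly parallel, and p loses
    only a second order term by going through a_T.  The product based at o is
    nondecreasing in T by the triangle inequality, and changing the base point
    adds Busemann functions, whence the first property.

    For the second one, hyperbolicity is used twice.  First, if the product
    based at o is at most K at some time T > K + 2 delta, it stays below
    K + 2 delta afterwards ([gromov_product_stable]).  Second, a geodesic from
    a_S to b_S then passes within D = K + 4 delta of o, at some point p
    ([geodesic_passes_near]).  As d(a_S, b_S) = d(a_S, p) + d(p, b_S), the
    product at time S is half the sum of d(o, a_S) - d(p, a_S) and
    d(o, b_S) - d(p, b_S), while at time T it is at least the corresponding
    expression by the triangle inequality; the rate above bounds the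
    difference. *)

(** * Comparison with the Euclidean plane *)

Section Comparison.
Context {R : realType} (X : metricType R).
Implicit Types (x y z w o p : X) (c : R -> X).

Definition isometric_upto (L : R) c :=
  {in `[0, L] &, forall s t, mdist (c s) (c t) = `|s - t|}.

Lemma isometric_upto_dist0 L c t :
  isometric_upto L c -> 0 <= t <= L -> mdist (c 0) (c t) = t.
Proof.
move=> cL /andP[t0 tL]; rewrite cL ?in_itv/= ?lexx ?(le_trans t0 tL) ?t0//.
by rewrite sub0r normrN ger0_norm.
Qed.

Lemma isometric_uptoS L M c :
  M <= L -> isometric_upto L c -> isometric_upto M c.
Proof.
move=> ML cL s t; rewrite !in_itv/= => /andP[s0 sM] /andP[t0 tM].
by apply: cL; rewrite in_itv/= ?s0 ?t0 (le_trans _ ML).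
Qed.

Lemma sqr_euclidean_dist (u v : R * R) :
  euclidean_dist u v ^+ 2 = (u.1 - v.1) ^+ 2 + (u.2 - v.2) ^+ 2.
Proof. by rewrite sqr_sqrtr// addr_ge0 ?sqr_ge0. Qed.

Lemma euclidean_distE (u v : R * R) (d : R) :
  0 <= d -> (u.1 - v.1) ^+ 2 + (u.2 - v.2) ^+ 2 = d ^+ 2 ->
  euclidean_dist u v = d.
Proof. by move=> d0 uv; rewrite /euclidean_dist uv sqrtr_sqr ger0_norm. Qed.

Lemma euclidean_distC (u v : R * R) : euclidean_dist u v = euclidean_dist v u.
Proof.
by rewrite /euclidean_dist -(sqrrN (u.1 - _)) -(sqrrN (u.2 - _)) !opprB.
Qed.

(** The third vertex is found from the law of cosines; its abscissa u satisfies
    u^2 <= d(x, z)^2 exactly by the triangle inequalities. *)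
Lemma comparison_triangle x y z : exists vb : R * R,
  [/\ euclidean_dist (0, 0) (mdist x y, 0) = mdist x y,
      euclidean_dist (mdist x y, 0) vb = mdist y z &
      euclidean_dist vb (0, 0) = mdist z x].
Proof.
set L := mdist x y; set a := mdist z x; set b := mdist y z.
have L0 : 0 <= L := mdist_ge0 _ _.
have a0 : 0 <= a := mdist_ge0 _ _.
have b0 : 0 <= b := mdist_ge0 _ _.
have tL : L <= a + b.
  by have := metric_triangle x z y; rewrite (metric_sym x z) (metric_sym z y).
have ta : a <= b + L.
  by have := metric_triangle z y x; rewrite (metric_sym z y) (metric_sym y x).
have tb : b <= L + a.
  by have := metric_triangle y x z; rewrite (metric_sym y x) (metric_sym x z).
(* The abscissa below divides by L. *)
have [L00|Ln0] := eqVneq L 0.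
  have ab : a = b by lra.
  exists (a, 0); split; apply: euclidean_distE => //=; rewrite ?L00 -?ab; ring.
pose u := (a ^+ 2 + L ^+ 2 - b ^+ 2) / (2 * L).
have Lp : 0 < L by rewrite lt_neqAle eq_sym Ln0.
have uL : 2 * L * u = a ^+ 2 + L ^+ 2 - b ^+ 2.
  by rewrite /u mulrC divfK// mulf_neq0// pnatr_eq0.
have ua : u ^+ 2 <= a ^+ 2.
  have ul : - a <= u.
    rewrite -(ler_pM2l (_ : 0 < 2 * L)) ?mulr_gt0// uL; nra.
  have uu : u <= a.
    rewrite -(ler_pM2l (_ : 0 < 2 * L)) ?mulr_gt0// uL; nra.
  nra.
have sq : Num.sqrt (a ^+ 2 - u ^+ 2) ^+ 2 = a ^+ 2 - u ^+ 2.
  by rewrite sqr_sqrtr// subr_ge0.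
exists (u, Num.sqrt (a ^+ 2 - u ^+ 2)).
split; apply: euclidean_distE => //=; rewrite ?sub0r ?subr0 ?sqrrN ?sq; lra.
Qed.

(** Stewart's theorem is an equality in the plane; comparing a vertex with a
    point of the opposite side turns it into an inequality.  It is multiplied
    by L, so that it also covers degenerate triangles. *)
Lemma CAT0_stewart p c L t : CAT0 X -> isometric_upto L c -> 0 <= t <= L ->
  L * mdist p (c t) ^+ 2 <=
    (L - t) * mdist p (c 0) ^+ 2 + t * mdist p (c L) ^+ 2 - L * t * (L - t).
Proof.
move=> [geo cat] cL tL; have /andP[t0 tL'] := tL; have L0 := le_trans t0 tL'.
have dL : mdist (c 0) (c L) = L.
  by rewrite (isometric_upto_dist0 cL)// L0 lexx.
have [c1 c1P] := geo (c L) p; have [c2 c2P] := geo p (c 0).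
have [pb [e01 e12 e20]] := comparison_triangle (c 0) (c L) p.
rewrite dL in e01 e12.
pose v (i : 'I_3) := nth (c 0) [:: c 0; c L; p] i.
pose cc (i : 'I_3) := nth c [:: c; c1; c2] i.
pose vb (i : 'I_3) := nth (0, 0) [:: (0, 0); (L, 0); pb] i.
have ccP i : geodesic_path (v i) (v (ordS i)) (cc i).
  case: i => [[|[|[|//]]] ?] //=.
  by rewrite /v /cc /= ; split => //; rewrite ?dL.
have vbP i j : euclidean_dist (vb i) (vb j) = mdist (v i) (v j).
  have e (u : R * R) : euclidean_dist u u = 0.
    by apply: euclidean_distE => //; ring.
  by case: i => [[|[|[|//]]] ?]; case: j => [[|[|[|//]]] ?];
    rewrite /vb /v /= ?e ?mdistxx // ?dL //;
    rewrite euclidean_distC ?e01 ?e12 ?e20 // ?(metric_sym (c L)) ?dL //;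
    rewrite metric_sym.
have H : mdist (c t) p <= euclidean_dist (t, 0) pb.
  (* p is the start of the side from p to c 0, so its comparison point is the
     vertex pb. *)
  have := cat v cc vb ccP vbP (inord 0) (inord 2) t 0 (t, 0) pb.
  rewrite /v /cc /vb /= !inordK //=.
  rewrite !in_itv/= dL lexx mdist_ge0 => /(_ tL isT).
  have [c20 _ _] := c2P; rewrite c20; apply.
  - split; apply: euclidean_distE => /=; rewrite ?mdist_ge0//.
      by rewrite (isometric_upto_dist0 cL)//; ring.
    rewrite cL ?in_itv/= ?L0 ?lexx ?t0//.
    rewrite ler0_norm ?subr_le0//; ring.
  - split; first by rewrite mdistxx; apply: euclidean_distE => //; ring.
    by rewrite e20.
have {}H : mdist p (c t) ^+ 2 <= euclidean_dist (t, 0) pb ^+ 2.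
  by rewrite ler_sqr ?nnegrE ?mdist_ge0 ?sqrtr_ge0// metric_sym.
rewrite sqr_euclidean_dist/= in H.
have := congr1 (fun r => r ^+ 2) e12; have := congr1 (fun r => r ^+ 2) e20.
rewrite !sqr_euclidean_dist/= !sub0r !subr0 (metric_sym (c L)) => h1 h2.
have := ler_wpM2l L0 H; rewrite -h1 -h2; lra.
Qed.

(** Stewart's inequality is applied twice: in the triangle c 0, c L, c' L it
    bounds d(c t, c' L), and in the triangle c 0, c t, c' L it then bounds
    d(c t, c' t). *)
Lemma CAT0_fellow_travel c c' L t : CAT0 X ->
  isometric_upto L c -> isometric_upto L c' -> c 0 = c' 0 -> 0 <= t <= L ->
  L * mdist (c t) (c' t) <= t * mdist (c L) (c' L).
Proof.
move=> cat cL cL' c0 tL; have /andP[t0 tL'] := tL; have L0 := le_trans t0 tL'.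
have LL : 0 <= L <= L by rewrite L0 lexx.
have h1 := CAT0_stewart (c t) cat cL' tL.
have h2 := CAT0_stewart (c' L) cat cL tL.
rewrite -c0 (metric_sym (c t) (c 0)) (isometric_upto_dist0 cL)// in h1.
rewrite c0 (metric_sym _ (c' 0)) (isometric_upto_dist0 cL')// in h2.
rewrite (metric_sym (c' L)) (metric_sym _ (c L)) in h2.
rewrite -ler_sqr ?nnegrE ?mulr_ge0 ?mdist_ge0// !exprMn.
have h3 := ler_wpM2l L0 h1; have h4 := ler_wpM2l t0 h2.
lra.
Qed.

(** * Geodesics that may stop *)

(** A common description of generalized rays to interior points and to the
    boundary: after any time T the path either has stopped, or is still
    geodesic up to a time L whose point c L is the one reached at time S. *)
Definition stopped_geodesic c := forall T S, 0 <= T -> T <= S ->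
  c S = c T \/ exists L, [/\ T <= L, isometric_upto L c & c S = c L].

Lemma stopped_geodesic_dist c T S : stopped_geodesic c -> 0 <= T -> T <= S ->
  mdist (c 0) (c S) = mdist (c 0) (c T) + mdist (c T) (c S).
Proof.
move=> cP T0 TS; have [->|[L [TL cL ->]]] := cP _ _ T0 TS.
  by rewrite mdistxx addr0.
have L0 := le_trans T0 TL.
rewrite !(isometric_upto_dist0 cL) ?T0 ?L0 ?lexx// cL ?in_itv/= ?T0 ?L0 ?lexx//.
by rewrite ler0_norm ?subr_le0//; ring.
Qed.

(** When c is a ray, the limit in T is the Busemann function of c at p. *)
Definition busemann c p T := mdist p (c T) - mdist (c 0) (c T).

Lemma busemann_nonincreasing c p T S : stopped_geodesic c -> 0 <= T -> T <= S ->
  busemann c p S <= busemann c p T.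
Proof.
move=> cP T0 TS; rewrite /busemann (stopped_geodesic_dist cP T0 TS).
by have := metric_triangle p (c T) (c S); lra.
Qed.

Lemma busemann_ge c p T : - mdist p (c 0) <= busemann c p T.
Proof.
rewrite /busemann; have := metric_triangle (c 0) p (c T).
by rewrite (metric_sym (c 0) p); lra.
Qed.

(** Writing d(p, c L) = L + g, Stewart's inequality becomes
    d(p, c T)^2 - (T + g)^2 <= (1 - T / L) (d(p, c 0)^2 - g^2) <= D^2, and the
    left side factors with d(p, c T) + T + g >= 2 (T - D). *)
Lemma CAT0_busemann_rate c p D T S : CAT0 X -> stopped_geodesic c ->
  mdist p (c 0) <= D -> D < T -> T <= S ->
  busemann c p T <= busemann c p S + D ^+ 2 / (2 * (T - D)).
Proof.
move=> cat cP pD DT TS.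
have a0 : 0 <= mdist p (c 0) := mdist_ge0 _ _.
have T0 : 0 <= T by lra.
have TD : 0 < 2 * (T - D) by lra.
have [|[L [TL cL]]] := cP _ _ T0 TS; rewrite /busemann => ->.
  by rewrite lerDl divr_ge0// ?sqr_ge0// ltW.
have L0 : 0 < L by lra.
have st : L * mdist p (c T) ^+ 2 <=
    (L - T) * mdist p (c 0) ^+ 2 + T * mdist p (c L) ^+ 2 - L * T * (L - T).
  by apply: CAT0_stewart; rewrite ?T0.
have tm := metric_triangle (c 0) p (c T).
have tb := metric_triangle (c 0) p (c L).
have tT := metric_triangle p (c T) (c L).
have dTL : mdist (c T) (c L) = L - T.
  rewrite cL ?in_itv/= ?T0 ?(ltW L0) ?lexx//.
  by rewrite ler0_norm ?subr_le0//; ring.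
rewrite dTL in tT; rewrite (metric_sym _ p) in tm tb.
rewrite !(isometric_upto_dist0 cL) ?T0 ?(ltW L0) ?lexx// in tm tb *.
set a := mdist p (c 0) in a0 pD st tm tb *.
set m := mdist p (c T) in st tm tT *.
set b := mdist p (c L) in st tb tT *.
clearbody a m b; set g := b - L.
have bE : b = L + g by rewrite /g; ring.
rewrite bE in st tb tT *.
have h : m ^+ 2 - (T + g) ^+ 2 <= D ^+ 2.
  rewrite -(ler_pM2l L0).
  have : (L - T) * (a ^+ 2 - g ^+ 2) <= L * D ^+ 2.
    have : a ^+ 2 <= D ^+ 2 by rewrite ler_sqr// nnegrE// (le_trans a0).
    have : 0 <= g ^+ 2 := sqr_ge0 g.
    have : 0 <= a ^+ 2 := sqr_ge0 a.
    nra.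
  lra.
rewrite -lerBlDl ler_pdivlMr//.
have : (m - T - g) * (2 * (T - D)) <= (m - T - g) * (m + (T + g)).
  by apply: ler_wpM2l; lra.
lra.
Qed.

Lemma gromov_product_ge0 w x y : 0 <= gromov_product w x y.
Proof.
rewrite /gromov_product divr_ge0//.
by have := metric_triangle x w y; rewrite (metric_sym x w); lra.
Qed.

Lemma gromov_productC w x y : gromov_product w x y = gromov_product w y x.
Proof. by rewrite /gromov_product (metric_sym x y) (addrC (mdist w x)). Qed.

Lemma gromov_product_busemann c c' x T : c 0 = c' 0 ->
  gromov_product x (c T) (c' T) = gromov_product (c 0) (c T) (c' T)
    + (busemann c x T + busemann c' x T) / 2.
Proof. by move=> c0; rewrite /gromov_product /busemann -c0; lra. Qed.

Lemma gromov_product_nondecreasing c c' T S :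
  stopped_geodesic c -> stopped_geodesic c' -> c 0 = c' 0 -> 0 <= T -> T <= S ->
  gromov_product (c 0) (c T) (c' T) <= gromov_product (c 0) (c S) (c' S).
Proof.
move=> cP cP' c0 T0 TS; rewrite /gromov_product.
rewrite (stopped_geodesic_dist cP T0 TS).
have := stopped_geodesic_dist cP' T0 TS; rewrite -c0 => ->.
have := metric_triangle (c S) (c T) (c' S).
have := metric_triangle (c T) (c' T) (c' S).
rewrite (metric_sym (c S) (c T)); lra.
Qed.

Lemma gromov_product_almost_nondecreasing c c' x D T S : CAT0 X ->
  stopped_geodesic c -> stopped_geodesic c' -> c 0 = c' 0 ->
  mdist x (c 0) <= D -> D < T -> T <= S ->
  gromov_product x (c T) (c' T) <=
    gromov_product x (c S) (c' S) + D ^+ 2 / (2 * (T - D)).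
Proof.
move=> cat cP cP' c0 xD DT TS; have x0 := mdist_ge0 x (c 0).
have T0 : 0 <= T by lra.
rewrite !(gromov_product_busemann x _ c0).
have := gromov_product_nondecreasing cP cP' c0 T0 TS.
have := CAT0_busemann_rate cat cP xD DT TS.
by rewrite c0 in xD; have := CAT0_busemann_rate cat cP' xD DT TS; lra.
Qed.

(** * Hyperbolicity *)

Section Hyperbolic.
Context (delta : R).
Hypothesis hyp : forall w x y z,
  Num.min (gromov_product w x y) (gromov_product w y z) - delta
    <= gromov_product w x z.

Lemma hyperbolicity_ge0 o : 0 <= delta.
Proof.
have := hyp o o o o.
by rewrite /gromov_product mdistxx !addr0 subr0 mul0r minxx sub0r oppr_le0.
Qed.

(** The point p where the inscribed circle would touch the geodesic, at
    distance (o|z)_y from y, satisfies (y|o)_p = (o|z)_p, both being half of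
    d(p, o) - (y|z)_o; the product (y|z)_p vanishes, so hyperbolicity
    bounds d(p, o). *)
Lemma geodesic_passes_near o y z : geodesic_space X ->
  exists2 p, mdist y p + mdist p z = mdist y z
           & mdist p o <= gromov_product o y z + 2 * delta.
Proof.
move=> geo; have [c [c0 c1 cP]] := geo y z.
have t1 := metric_triangle y o z; have t2 := metric_triangle y z o.
have t3 := metric_triangle z y o; have y0 : 0 <= mdist y z := mdist_ge0 _ _.
rewrite (metric_sym y o) (metric_sym z o) (metric_sym z y) in t1 t2 t3.
pose s := (mdist o y + mdist y z - mdist o z) / 2.
have s0 : 0 <= s by rewrite /s; lra.
have sL : s <= mdist y z by rewrite /s; lra.
have dy : mdist y (c s) = s.
  rewrite -{1}c0 cP ?in_itv/= ?lexx ?s0//.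
  by rewrite sub0r normrN ger0_norm.
have dz : mdist (c s) z = mdist y z - s.
  rewrite -{1}c1 cP ?in_itv/= ?lexx ?s0 ?y0//.
  by rewrite ler0_norm ?subr_le0//; ring.
exists (c s); first by rewrite dy dz; ring.
have := hyp (c s) y o z; rewrite /gromov_product (metric_sym (c s) y) dy dz.
rewrite (metric_sym y o) (metric_sym (c s) o).
rewrite /s;rewrite /Order.min; case: ifP => _; lra.
Qed.

(** Unless the path has stopped at time T, the product (c T|c S) equals T, too
    large to be the minimum in the hyperbolicity inequality.  So replacing c' T
    by c' S, and then c T by c S, costs at most delta each time. *)
Lemma gromov_product_stable c c' K T S :
  stopped_geodesic c -> stopped_geodesic c' -> c 0 = c' 0 ->
  gromov_product (c 0) (c T) (c' T) <= K -> K + 2 * delta < T -> T <= S ->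
  gromov_product (c 0) (c S) (c' S) <= K + 2 * delta.
Proof.
move=> cP cP' c0 GK KT TS.
have d0 := hyperbolicity_ge0 (c 0).
have K0 := le_trans (gromov_product_ge0 _ _ _) GK.
have T0 : 0 <= T by lra.
have far (e : R -> X) : stopped_geodesic e -> e 0 = c 0 ->
    e S = e T \/ gromov_product (c 0) (e T) (e S) = T.
  move=> eP e0; have eTS := stopped_geodesic_dist eP T0 TS.
  case: (eP _ _ T0 TS) => [->|[L [TL eL eSL]]]; [by left|right].
  rewrite /gromov_product -e0 eTS.
  by rewrite (isometric_upto_dist0 eL) ?T0//; lra.
have h1 : gromov_product (c 0) (c T) (c' S) <= K + delta.
  case: (far c' cP' (esym c0)) => [->|e]; first lra.
  have := hyp (c 0) (c T) (c' S) (c' T); rewrite (gromov_productC _ (c' S)) e.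
  rewrite /Order.min; case: ifP => _; lra.
case: (far c cP erefl) => [->|e]; first lra.
have := hyp (c 0) (c T) (c S) (c' S); rewrite e.
rewrite /Order.min; case: ifP => _; lra.
Qed.

(** The geodesic from c S to c' S comes close to c 0 at a point p.  The
    product at time S is exactly minus half the sum of the Busemann functions
    at p, and the product at time T is at least the analogous quantity. *)
Lemma gromov_product_rate_basepoint c c' K D T S : CAT0 X ->
  stopped_geodesic c -> stopped_geodesic c' -> c 0 = c' 0 ->
  gromov_product (c 0) (c T) (c' T) <= K -> K + 4 * delta <= D ->
  D < T -> T <= S ->
  gromov_product (c 0) (c S) (c' S) <=
    gromov_product (c 0) (c T) (c' T) + D ^+ 2 / (2 * (T - D)).
Proof.
move=> cat cP cP' c0 GK KD DT TS.
have d0 := hyperbolicity_ge0 (c 0).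
have GS : gromov_product (c 0) (c S) (c' S) <= K + 2 * delta.
  by apply: gromov_product_stable GK _ TS => //; lra.
have [p pyz po] := geodesic_passes_near (c 0) (c S) (c' S) cat.1.
have {po} po : mdist p (c 0) <= D by lra.
have po' : mdist p (c' 0) <= D by rewrite -c0.
have := CAT0_busemann_rate cat cP po DT TS.
have := CAT0_busemann_rate cat cP' po' DT TS.
have := metric_triangle (c T) p (c' T).
rewrite /busemann /gromov_product -c0 -pyz.
rewrite (metric_sym _ p) (metric_sym (c S)); lra.
Qed.

(** The Busemann terms that change the base point are at least - d(x, c 0), so a
    bound K at x gives the bound K + d(x, c 0) at c 0; being nonincreasing, they
    add nothing to the error. *)
Lemma gromov_product_rate c c' x K D T S : CAT0 X ->
  stopped_geodesic c -> stopped_geodesic c' -> c 0 = c' 0 ->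
  gromov_product x (c T) (c' T) <= K -> K + mdist x (c 0) + 4 * delta <= D ->
  D < T -> T <= S ->
  gromov_product x (c S) (c' S) <=
    gromov_product x (c T) (c' T) + D ^+ 2 / (2 * (T - D)).
Proof.
move=> cat cP cP' c0 GK KD DT TS; have x0 := mdist_ge0 x (c 0).
have d0 := hyperbolicity_ge0 x.
have K0 := le_trans (gromov_product_ge0 _ _ _) GK.
have T0 : 0 <= T by lra.
rewrite (gromov_product_busemann x _ c0) in GK.
rewrite !(gromov_product_busemann x _ c0).
have b1 := busemann_ge c x T; have b2 := busemann_ge c' x T.
rewrite -c0 in b2.
have GK' : gromov_product (c 0) (c T) (c' T) <= K + mdist x (c 0) by lra.
have := gromov_product_rate_basepoint cat cP cP' c0 GK' KD DT TS.
have := busemann_nonincreasing x cP T0 TS.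
by have := busemann_nonincreasing x cP' T0 TS; lra.
Qed.

End Hyperbolic.
End Comparison.

(** * Limits of functions that converge uniformly on sublevel sets *)

Lemma rate_small (R : realType) (D e : R) : 0 < e ->
  exists N : nat, forall T, N%:R <= T -> D < T /\ D ^+ 2 / (2 * (T - D)) <= e.
Proof.
move=> e0; exists (Num.trunc (`|D| + 1 + D ^+ 2 / e)).+1 => T NT.
have lt := lt_le_trans (truncnS_gt _) NT.
have De : 0 <= D ^+ 2 / e by rewrite divr_ge0 ?sqr_ge0// ltW.
have DD := ler_norm D.
have DT : D < T by lra.
split=> //; rewrite ler_pdivrMr; last by lra.
have : e * (D ^+ 2 / e) <= e * (2 * (T - D)).
  by apply: ler_wpM2l; [exact: ltW|lra].
by rewrite mulrC divfK// gt_eqF.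
Qed.

Section LimnEsup.
Context {R : realType}.
Local Open Scope ereal_scope.

Lemma limn_esup_le (u : (\bar R)^nat) (l : \bar R) (N : nat) :
  (forall n, (N <= n)%N -> u n <= l) -> limn_esup u <= l.
Proof.
move=> ul; set V := [set n | (N <= n)%N].
apply: (@le_trans _ _ (ereal_sup [set u n | n in V])).
  apply: ereal_inf_lbound; exists V => //.
  exact: nbhs_infty_ge.
by apply: ge_ereal_sup => _ [n Nn <-]; exact: ul.
Qed.

Lemma limn_esup_ge (u : (\bar R)^nat) (l : \bar R) (N : nat) :
  (forall n, (N <= n)%N -> l <= u n) -> l <= limn_esup u.
Proof.
move=> lu; apply: le_ereal_inf_tmp => _ [V [M _ MV] <-].
apply: (@le_trans _ _ (u (maxn M N))); first by rewrite lu// leq_maxr.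
by apply: ereal_sup_ubound; exists (maxn M N) => //; apply: MV; exact: leq_maxl.
Qed.
End LimnEsup.

Section SublevelLimit.
Context {R : realType} {Z : topologicalType} (F : nat -> Z -> R).
Hypothesis Fcont : forall n, continuous (F n).
Hypothesis Flow : forall e, 0 < e -> exists N, forall m n z,
  (N <= m <= n)%N -> F m z <= F n z + e.
Hypothesis Fup : forall K e, 0 < e -> exists N, forall m n z,
  (N <= m <= n)%N -> F m z <= K -> F n z <= F m z + e.

Let f z := limn_esup (fun n => (F n z)%:E).

(** Where the limit is infinite, a large value of some F m persists nearby and
    bounds the limit from below.  Where it is a real number r, some F m is close
    to the limit, stays below r + 1 nearby, and is therefore close to the limit
    on a whole neighbourhood. *)
Lemma continuous_limn_esup_sublevel : continuous f.
Proof.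
move=> z.
have lo e : 0 < e -> exists N, forall m w, (N <= m)%N ->
    ((F m w - e)%:E <= f w)%E.
  move=> /Flow[N HN]; exists N => m w Nm.
  apply: (@limn_esup_ge _ _ _ m) => n mn.
  by rewrite lee_fin lerBlDr HN// Nm.
have up K e : 0 < e -> exists N, forall m w, (N <= m)%N -> F m w <= K ->
    (f w <= (F m w + e)%:E)%E.
  move=> /(Fup K)[N HN]; exists N => m w Nm mK.
  by apply: (@limn_esup_le _ _ _ m) => n mn; rewrite lee_fin HN// Nm.
have Fnear n e : 0 < e -> \forall w \near z, `|F n z - F n w| < e.
  by move=> e0; have /cvgrPdist_lt/(_ e e0) := @Fcont n z.
rewrite /continuous_at; case fz : (f z) => [r| |]; last first.
- by have [N /(_ N z (leqnn N))] := lo 1 ltr01; rewrite fz leeNy_eq.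
- apply/cvgeyPgt => A; have [N HN] := lo 1 ltr01.
  have [m Nm Fm] : exists2 m, (N <= m)%N & A + 2 < F m z.
    apply: contrapT => H; have : (f z <= (A + 2)%:E)%E.
      apply: (@limn_esup_le _ _ _ N) => n Nn; rewrite lee_fin leNgt.
      by apply/negP => An; apply: H; exists n.
    by rewrite fz leye_eq.
  near=> w; apply: lt_le_trans (HN m w Nm); rewrite lte_fin.
  have : `|F m z - F m w| < 1 by near: w; exact: Fnear.
  by rewrite ltr_norml => /andP[_]; lra.
apply/fine_cvgP.
have main e : 0 < e -> e <= 1 -> \forall w \near z,
    ((r - e)%:E <= f w <= (r + e)%:E)%E.
  move=> e0 e1; have e40 : 0 < e / 4 by lra.
  have [N1 H1] := lo _ e40; have [N2 H2] := up (r + 1) _ e40.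
  pose m := maxn N1 N2.
  have {}H1 := H1 m _ (leq_maxl _ _); have {}H2 := H2 m _ (leq_maxr _ _).
  have mz := H1 z; rewrite fz lee_fin in mz.
  have zm : (f z <= (F m z + e / 4)%:E)%E by apply: H2; lra.
  rewrite fz lee_fin in zm.
  near=> w.
  have : `|F m z - F m w| < e / 4 by near: w; exact: Fnear.
  rewrite ltr_norml => /andP[h1 h2]; apply/andP; split.
    by apply: le_trans (H1 w); rewrite lee_fin; lra.
  by apply: le_trans (H2 w _) _; rewrite ?lee_fin; lra.
split.
  near=> w; have : ((r - 1)%:E <= f w <= (r + 1)%:E)%E.
    by near: w; exact: main.
  by case: (f w) => // /andP[].
apply/cvgrPdist_le => e e0; near=> w.
have : ((r - Num.min e 1)%:E <= f w <= (r + Num.min e 1)%:E)%E.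
  by near: w; apply: main; rewrite ?lt_min ?e0 ?ltr01// ge_min lexx orbT.
have me : Num.min e 1 <= e by rewrite ge_min lexx.
move=> /andP[]; rewrite /=; case: (f w) => [s| |] //=.
rewrite !lee_fin => h1 h2.
by rewrite ler_norml; apply/andP; split; lra.
Unshelve. all: by end_near. Qed.
End SublevelLimit.

(** * Generalized rays and the visual compactification *)

Section Rays.
Context {R : realType} (X : metricType R) (o : X).
Implicit Types (a b : visual_compactification o) (c : R -> X).

Lemma ray_isometric_upto (g : geodesic_ray X) L : isometric_upto L g.
Proof.
move=> s t; rewrite !in_itv/= => /andP[s0 _] /andP[t0 _].
exact: ray_isometric.
Qed.

Lemma generalized_ray0 a c : generalized_ray a c -> c 0 = o.
Proof. by case: a => [y [[]]|xi [g []]]. Qed.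

Lemma generalized_ray_stopped a c : generalized_ray a c -> stopped_geodesic c.
Proof.
move=> ac T S T0 TS.
case: a ac => [y [[c0 cy cP] cstop]|xi [g [-> _ _]]]; last first.
  by right; exists S; split => //; exact: ray_isometric_upto.
have [yT|/ltW Ty] := leP (mdist o y) T.
  by left; rewrite !cstop// (le_trans yT).
right; have [yS|/ltW Sy] := leP (mdist o y) S.
  by exists (mdist o y); split => //; rewrite cy cstop.
by exists S; split => //; exact: isometric_uptoS Sy cP.
Qed.

(** Geodesics issuing from o at distance K at time L are at distance at most
    t K / L at time t.  For two geodesics to the same point K = 0; for two
    asymptotic rays K is a constant and L is arbitrarily large. *)
Lemma generalized_ray_unique a c c' t : CAT0 X ->
  generalized_ray a c -> generalized_ray a c' -> 0 <= t -> c t = c' t.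
Proof.
move=> cat ca ca' t0.
have c00 : c 0 = c' 0 by rewrite (generalized_ray0 ca) (generalized_ray0 ca').
case: a ca ca' => [y [[c0 cy cP] cs] [[c0' cy' cP'] cs']|xi].
  have [yt|ty] := leP (mdist o y) t; first by rewrite cs// cs'.
  apply: mdist_positivity; apply/eqP; rewrite eq_le mdist_ge0 andbT.
  rewrite -(ler_pM2l (le_lt_trans t0 ty)) mulr0.
  have tL : 0 <= t <= mdist o y by rewrite t0 ltW.
  by have := CAT0_fellow_travel cat cP cP' c00 tL; rewrite cy cy' mdistxx mulr0.
move=> [g [eg _ gxi]] [h [eh _ hxi]]; subst c c'.
have /eqmodP/asboolP[K gh] := etrans gxi (esym hxi).
apply: mdist_positivity; apply/eqP; rewrite eq_le mdist_ge0 andbT.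
apply/ler_addgt0Pr => e e0; rewrite add0r.
have K0 : 0 <= K := le_trans (mdist_ge0 _ _) (gh _ t0).
pose L := t + t * K / e + 1.
have tKe : 0 <= t * K / e by rewrite divr_ge0 ?mulr_ge0// ltW.
have L0 : 0 < L by rewrite /L; lra.
have tL : 0 <= t <= L by rewrite t0 /L; lra.
have := CAT0_fellow_travel cat (@ray_isometric_upto g L)
  (@ray_isometric_upto h L) c00 tL.
have := ler_wpM2l t0 (gh _ (ltW L0)).
move=> h1 h2; rewrite -(ler_pM2l L0) (le_trans h2)// (le_trans h1)//.
have -> : t * K = (t * K / e) * e by rewrite divfK// gt_eqF.
by rewrite ler_pM2r// /L; lra.
Qed.

(** The default value is harmless: a point reached by no generalized ray is not
    the limit of any sequence, so it is isolated. *)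
Definition ray a : R -> X := xget (fun=> o) [set c | generalized_ray a c].

Lemma rayP a c : generalized_ray a c -> generalized_ray a (ray a).
Proof. by move=> ca; exact: (xgetPex (fun=> o) (ex_intro _ c ca)). Qed.

Lemma rayE a c t : CAT0 X -> generalized_ray a c -> 0 <= t -> c t = ray a t.
Proof. by move=> cat ca; apply: generalized_ray_unique (ca) (rayP ca). Qed.

Lemma ray0 a : ray a 0 = o.
Proof.
by rewrite /ray; case: xgetP => [c _ /generalized_ray0|].
Qed.

Lemma ray_stopped a : stopped_geodesic (ray a).
Proof.
rewrite /ray; case: xgetP => [c _ /generalized_ray_stopped//|_ T S _ _].
by left.
Qed.

Lemma ray_inl y t : CAT0 X -> mdist o y <= t -> ray (inl y) t = y.
Proof.
move=> cat yt; have [c [c0 cy cP]] := cat.1 o y.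
pose c' t := if t <= mdist o y then c t else y.
have c'E t' : t' <= mdist o y -> c' t' = c t' by rewrite /c' => ->.
suff gc : @generalized_ray _ _ o (inl y) c'.
  rewrite -(rayE cat gc) ?(le_trans (mdist_ge0 o y))//.
  by case: gc => _; exact.
split; first split.
- by rewrite c'E ?mdist_ge0.
- by rewrite c'E.
- move=> s u; rewrite !in_itv/= => /andP[s0 sy] /andP[u0 uy].
  by rewrite !c'E// cP// in_itv/= ?s0 ?u0.
- move=> u yu; rewrite /c'; case: ifP => // uy.
  by have -> : u = mdist o y by apply/eqP; rewrite eq_le uy yu.
Qed.

(** Only the preimages of balls have to be shown open, and their complements are
    sequentially closed because convergent sequences have, along subsequences,
    rays that converge at time T. *)
Lemma ray_continuous T : CAT0 X -> 0 <= T ->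
  continuous (fun a : visual_compactification o => ray a T).
Proof.
move=> cat T0 a.
apply/(metricType_numDomainType.cvgrPdist_lt (FF := nbhs_filter a)) => e e0.
pose B := [set b | mdist (ray a T) (ray b T) < e].
suff oB : open B.
  by apply: open_nbhs_nbhs; split => //; rewrite /B/= mdistxx.
move=> u b uB [c_ [cu cb]] Bb.
have [//|psi _ [c bc cc]] := cb id.
have e'0 : 0 < e - mdist (ray a T) (ray b T) by rewrite subr_gt0.
have [N _ HN] := cc T _ e'0.
have := HN N (leqnn N) T; rewrite in_itv/= T0 lexx => /(_ isT).
rewrite (rayE cat bc T0) (rayE cat (cu _) T0) => h.
apply: (uB (psi N)); rewrite /B/=.
have := metric_triangle (ray a T) (ray b T) (ray (u (psi N)) T).
by rewrite (metric_sym (ray b T)); lra.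
Qed.

Lemma gromov_product_ray_continuous x T : CAT0 X -> 0 <= T ->
  continuous (fun ab : visual_compactification o * visual_compactification o =>
    gromov_product x (ray ab.1 T) (ray ab.2 T)).
Proof.
move=> cat T0 [a b]; apply/cvgrPdist_lt => e e0.
have e20 : 0 < e / 2 by lra.
have ha := metricType_numDomainType.cvgr_dist_lt
  (ray_continuous cat T0 (x:=a)) e20.
have hb := metricType_numDomainType.cvgr_dist_lt
  (ray_continuous cat T0 (x:=b)) e20.
exists ([set a' | mdist (ray a T) (ray a' T) < e / 2],
        [set b' | mdist (ray b T) (ray b' T) < e / 2]).
  by split; [exact: ha|exact: hb].
move=> [a' b'] /= [h1 h2]; rewrite /gromov_product.
have t1 := metric_triangle x (ray a T) (ray a' T).
have t2 := metric_triangle x (ray a' T) (ray a T).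
have t3 := metric_triangle x (ray b T) (ray b' T).
have t4 := metric_triangle x (ray b' T) (ray b T).
have t5 := metric_triangle (ray a T) (ray a' T) (ray b T).
have t6 := metric_triangle (ray a' T) (ray b' T) (ray b T).
have t7 := metric_triangle (ray a' T) (ray a T) (ray b' T).
have t8 := metric_triangle (ray a T) (ray b T) (ray b' T).
rewrite (metric_sym (ray a' T) (ray a T)) in t2 t7.
rewrite (metric_sym (ray b' T) (ray b T)) in t4 t6.
by rewrite ltr_norml; apply/andP; split; lra.
Qed.
End Rays.

Theorem proposition5p15 (R : realType) (X : metricType R) :
  proper_space X -> CAT0 X -> gromov_hyperbolic X -> boundary_continuous X.
Proof.
move=> _ cat [delta hyp] o x.
pose F n (ab : visual_compactification o * visual_compactification o) : R :=
  gromov_product x (ray ab.1 n%:R) (ray ab.2 n%:R).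
have r00 (a b : visual_compactification o) : ray a 0 = ray b 0.
  by rewrite !ray0.
exists (fun ab => limn_esup (fun n => (F n ab)%:E)); split => [|ab|y z].
- apply: continuous_limn_esup_sublevel => [n|e e0|K e e0].
  + exact: gromov_product_ray_continuous.
  + have [N HN] := rate_small (mdist x o) e0.
    exists N => m n ab /andP[Nm mn].
    have [|Dm me] := HN m%:R; first by rewrite ler_nat.
    apply: le_trans (gromov_product_almost_nondecreasing cat
      (@ray_stopped _ _ _ _) (@ray_stopped _ _ _ _) (r00 _ _)
      _ Dm (_ : _ <= n%:R)) _;
      rewrite ?ray0 ?ler_nat//; exact: lerD.
  + have [N HN] := rate_small (K + mdist x o + 4 * delta) e0.
    exists N => m n ab /andP[Nm mn] FK.
    have [|Dm me] := HN m%:R; first by rewrite ler_nat.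
    apply: le_trans (gromov_product_rate hyp cat (@ray_stopped _ _ _ _)
      (@ray_stopped _ _ _ _) (r00 _ _) FK _ Dm (_ : _ <= n%:R)) _;
      rewrite ?ray0 ?ler_nat//; exact: lerD.
- by apply: (@limn_esup_ge _ _ _ 0) => n _; rewrite lee_fin gromov_product_ge0.
(* From time d(o, y) + d(o, z) on, both rays have stopped at y and z. *)
pose N := (Num.trunc (mdist o y + mdist o z)).+1.
have FE n : (N <= n)%N -> F n (inl y, inl z) = gromov_product x y z.
  move=> Nn; have lt : mdist o y + mdist o z < n%:R.
    by apply: lt_le_trans (truncnS_gt _) _; rewrite ler_nat.
  have y0 := mdist_ge0 o y; have z0 := mdist_ge0 o z.
  by rewrite /F /= !ray_inl//; lra.
apply/eqP; rewrite eq_le; apply/andP; split.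
  by apply: (@limn_esup_le _ _ _ N) => n /FE ->.
by apply: (@limn_esup_ge _ _ _ N) => n /FE ->.
Qed.
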